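(* Let $G=(V,E)$ be a connected graph such that $(V,\mathcal{M}_{m^3_3}(G))$ is a convex geometry, where $\mathcal{M}_{m^3_3}(G)$ is the collection of all $m^3_3$-convex subsets of $V$. Then $G$ is $A$-free, i.e. $G$ contains no induced subgraph isomorphic to the $A$-graph.
   Context: All graphs are finite and simple. A path in $G$ is induced if it is an induced subgraph of $G$; its length is its number of edges. For vertices $u,v$, the monophonic interval $I_m[u,v]$ is the set of all vertices lying on some induced $u$–$v$ path. The $m^3$-interval $I_{m^3}[u,v]$ is the set of all vertices lying on some induced $u$–$v$ path of length at least $3$. A set $S\subseteq V$ is $m^3$-convex if $I_{m^3}[u,v]\subseteq S$ for all $u,v\in S$. For $U\subseteq V$ with $|U|\ge 2$, a minimal $U$-tree is a subgraph $T$ of $G$ containing $U$ such that $T$ is a tree and every vertex of $V(T)\setminus U$ is a cut-vertex of the subgraph of $G$ induced by $V(T)$; the monophonic interval $I_m(U)$ is the set of all vertices lying in some minimal $U$-tree. A set $S$ is $m_3$-convex if $I_m(U)\subseteq S$ for every $3$-element subset $U\subseteq S$. A set is $m^3_3$-convex if it is both $m^3$-convex and $m_3$-convex. An alignment of a finite set $V$ is a family $\mathcal{M}$ of subsets of $V$ closed under intersection and containing $\emptyset$ and $V$; its members are called convex sets. The convex hull of $S\subseteq V$ is the smallest convex set containing $S$. For $X\in\mathcal{M}$, $x\in X$ is an extreme point of $X$ if $X\setminus\{x\}\in\mathcal{M}$. $(V,\mathcal{M})$ is a convex geometry if every convex set is the convex hull of its set of extreme points. The $A$-graph is the graph on six vertices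 $a,b,u_1,u_2,u_3,u_4$ with edge set $\{u_1u_2,u_2u_3,u_3u_4,u_4u_1,au_1,bu_4\}$ (an induced $4$-cycle with a pendant vertex attached to each of two adjacent cycle vertices). $G$ is $F$-free if it has no induced subgraph isomorphic to $F$. *)

(* Defs.v *)
(* Simple graph = symmetric irreflexive relation e on a finType T. *)
From mathcomp Require Import all_boot.
Set Implicit Arguments. Unset Strict Implicit. Unset Printing Implicit Defensive.

Section Graphs.
Variables (T : finType) (e : rel T).

Definition induced_path (u v : T) (p : seq T) : Prop :=
  exists s, p = u :: s /\ last u s = v /\ uniq p /\
    forall i j, i < size p -> j < size p ->
      e (nth u p i) (nth u p j) = (j == i.+1) || (i == j.+1).

(* length = number of edges = size p - 1 *)
Definition in_m3_interval (u v x : T) : Prop :=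
  exists p, induced_path u v p /\ 3 <= (size p).-1 /\ x \in p.

Definition m3_convex (S : {set T}) : Prop :=
  forall u v x, u \in S -> v \in S -> in_m3_interval u v x -> x \in S.

Definition induced_rel (W : {set T}) : rel T :=
  [rel x y | e x y && (x \in W) && (y \in W)].

Definition cut_vertex (W : {set T}) (x : T) : Prop :=
  x \in W /\ exists y z, [/\ y \in W :\ x, z \in W :\ x,
     connect (induced_rel W) y z & ~~ connect (induced_rel (W :\ x)) y z].

Definition subgraph (W : {set T}) (f : rel T) : Prop :=
  (forall x y, f x y -> [&& e x y, x \in W & y \in W]) /\
  (forall x y, f x y = f y x).

Definition has_cycle (f : rel T) : Prop :=
  exists c : seq T, 3 <= size c /\ uniq c /\ cycle f c.

Definition is_tree (W : {set T}) (f : rel T) : Prop :=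
  W != set0 /\ (forall x y, x \in W -> y \in W -> connect f x y) /\ ~ has_cycle f.

Definition minimal_tree (U W : {set T}) (f : rel T) : Prop :=
  [/\ U \subset W, subgraph W f, is_tree W f &
      forall x, x \in W -> x \notin U -> cut_vertex W x].

Definition in_m_interval_set (U : {set T}) (x : T) : Prop :=
  exists W f, minimal_tree U W f /\ x \in W.

Definition m_3_convex (S : {set T}) : Prop :=
  forall U : {set T}, #|U| = 3 -> U \subset S ->
    forall x, in_m_interval_set U x -> x \in S.

Definition m33_convex (S : {set T}) : Prop := m3_convex S /\ m_3_convex S.

Definition connected_graph : Prop := forall x y : T, connect e x y.

(* A-graph on 'I_6: 0=a, 1=b, 2=u1, 3=u2, 4=u3, 5=u4 *)
Definition A_edges : seq (nat * nat) :=
  [:: (2,3); (3,4); (4,5); (5,2); (0,2); (1,5)].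
Definition A_adj (i j : 'I_6) : bool :=
  ((nat_of_ord i, nat_of_ord j) \in A_edges) || ((nat_of_ord j, nat_of_ord i) \in A_edges).

Definition has_induced_A : Prop :=
  exists g : 'I_6 -> T, injective g /\ forall i j, e (g i) (g j) = A_adj i j.

End Graphs.

Section ConvexGeometry.
Variable T : finType.
Definition extreme_point (M : {set T} -> Prop) (X : {set T}) (x : T) : Prop :=
  x \in X /\ M (X :\ x).

Definition in_hull (M : {set T} -> Prop) (P : T -> Prop) (x : T) : Prop :=
  forall C, M C -> (forall y, P y -> y \in C) -> x \in C.

Definition convex_geometry (M : {set T} -> Prop) : Prop :=
  forall X, M X -> forall x, x \in X <-> in_hull M (extreme_point M X) x.
End ConvexGeometry.

(* Main.v *)
(* Let X be a minimal m^3_3-convex set containing an induced A-graph.  Its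
   extreme points lie in every A-graph inside X, and only the pendant vertices a
   and b can be extreme, so X is the hull of {a,b} and both a and b are extreme.
   The same minimality argument excludes induced houses.  Since a is extreme, two
   nonadjacent neighbours of a are false twins in X, and a is not the centre of a
   claw; likewise for b.  House-freeness and the minimality of X show that every
   private neighbour of a is adjacent to every private neighbour of b.  Hence any
   two nonadjacent vertices of N(a) u N(b) are false twins in X, which forces
   K = N[a] u N[b] to be convex in X.  But K misses the vertex u2, although the
   hull X of {a,b} contains it. *)
Require Import Defs.
From mathcomp Require Import all_boot.

Set Implicit Arguments. Unset Strict Implicit. Unset Printing Implicit Defensive.

Section Graph.
Variables (T : finType) (e : rel T).
Hypothesis e_sym : symmetric e.
Hypothesis e_irr : irreflexive e.

Local Ltac adj := first [assumption | rewrite e_sym; assumption].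

(** * Induced paths on four vertices and connectivity in induced subgraphs *)

Lemma separated_neq x y z : e x z -> e y z = false -> x != y.
Proof. by move=> xz yz; apply/eqP=> xy; rewrite xy yz in xz. Qed.

Lemma edge_neq x y : e x y -> x != y.
Proof. by move=> xy; apply/eqP=> E; rewrite E e_irr in xy. Qed.

Lemma m3_convex_P4 (S : {set T}) u x y v :
  m3_convex e S -> u \in S -> v \in S -> e u x -> e x y -> e y v ->
  e u y = false -> e u v = false -> e x v = false -> x \in S /\ y \in S.
Proof.
move=> cS uS vS ux xy yv uy uv xv.
have nux := edge_neq ux; have nxy := edge_neq xy; have nyv := edge_neq yv.
have nuy : u != y by rewrite eq_sym; apply: (@separated_neq y u v).
have nxv : x != v by apply: (@separated_neq x v u); adj.
have nuv : u != v by rewrite eq_sym; apply: (@separated_neq v u y); adj.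
have path : induced_path e u v [:: u; x; y; v].
  exists [:: x; y; v]; do !split=> //.
    by rewrite /= !inE !negb_or nux nuy nuv nxy nxv nyv.
  move=> [|[|[|[|i]]]] [|[|[|[|j]]]] //= _ _; rewrite ?e_irr //;
    by adj.
by split; apply: (cS u v) => //; exists [:: u; x; y; v]; rewrite !inE eqxx ?orbT.
Qed.

Lemma connect_induced_in (W : {set T}) x y :
  x \in W -> connect (induced_rel e W) x y -> y \in W.
Proof.
move=> xW /connectP[p]; elim: p x xW => [|z p IH] x xW /=; first by move=> _ ->.
by case/andP=> /andP[_ zW]; apply: IH.
Qed.

Lemma induced_rel_sym (W : {set T}) : symmetric (induced_rel e W).
Proof. by move=> x y; rewrite /induced_rel /= e_sym -!andbA; congr andb; rewrite andbC. Qed.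

Lemma connect_induced_sym (W : {set T}) : connect_sym (induced_rel e W).
Proof. exact/sym_connect_sym/induced_rel_sym. Qed.

Lemma connect_neighbor (W : {set T}) x y :
  connect (induced_rel e W) x y -> x != y ->
  exists z, [/\ e x z, x \in W & z \in W].
Proof.
case/connectP=> [[|z p]] /=; first by move=> _ -> /eqP.
by case/andP=> /andP[/andP[xz xW] zW] _ _ _; exists z.
Qed.

(** * Four-vertex minimal trees *)

Lemma cycle_two_neighbors (f : rel T) c v :
  symmetric f -> 3 <= size c -> uniq c -> cycle f c -> v \in c ->
  exists x y, [/\ x \in c, y \in c, x != y, f v x & f v y].
Proof.
move=> fS c3 cU cC /rot_to[i s Ei].
have : 3 <= size (v :: s) by rewrite -Ei size_rot.
have : uniq (v :: s) by rewrite -Ei rot_uniq.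
have : cycle f (v :: s) by rewrite -Ei rot_cycle.
have mem x : x \in v :: s -> x \in c by rewrite -Ei mem_rot.
case: s mem {Ei} => [|x s] // mem; case/lastP: s mem => [|s y] // mem.
rewrite /= rcons_path => /andP[vx /andP[_]]; rewrite last_rcons => yv.
move=> /and3P[_ xs _] _; exists x, y; split=> //.
- by apply: mem; rewrite !inE eqxx orbT.
- by apply: mem; rewrite !inE mem_rcons inE eqxx !orbT.
- by apply/eqP=> xy; rewrite xy mem_rcons inE eqxx in xs.
- by rewrite fS.
Qed.

(* Otherwise x - a - y together with z, hung on any of its neighbours, is a
   minimal {x,y,z}-tree through a. *)
Lemma cherry_extension (S : {set T}) a x y z :
  m_3_convex e S -> a \notin S -> x \in S -> y \in S -> z \in S ->
  e a x -> e a y -> e x y = false -> x != y -> z != x -> z != y ->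
  [|| e z a, e z x | e z y] -> e z x && e z y.
Proof.
move=> cS aS xS yS zS ax ay xy nxy nzx nzy zadj.
apply/negPn/negP=> nz; apply: (negP aS).
have nzs s : s \in S -> (a == s) = false.
  by move=> sS; apply/eqP=> E; rewrite E sS in aS.
pose U := [set x; y; z]; pose W := [set x; y; z; a].
(* [c] is the vertex on which [z] is hung. *)
have [c cW [zc nac]] : exists2 c, c \in [set x; y; a] & e z c /\ c != z.
  case/or3P: zadj => h; [exists a | exists x | exists y];
    rewrite ?inE ?eqxx ?orbT //; split=> //; first by rewrite nzs.
  - by rewrite eq_sym. - by rewrite eq_sym.
(* The tree: symmetric closure of the three edges [ax], [ay] and [cz]. *)
pose f := [rel u v | [|| [&& u == a & v == x], [&& u == x & v == a],
   [&& u == a & v == y], [&& u == y & v == a],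
   [&& u == c & v == z] | [&& u == z & v == c]]].
have fS : symmetric f.
  by move=> u v /=; do !case: eqP => ? //=.
have nax := nzs x xS; have nay := nzs y yS; have naz := nzs z zS.
have nxa : (x == a) = false by rewrite eq_sym.
have nya : (y == a) = false by rewrite eq_sym.
have nza : (z == a) = false by rewrite eq_sym.
have nyx : (y == x) = false by rewrite eq_sym; apply/negbTE.
have fW u v : f u v -> u \in [set x; y; z; a].
  case/or4P=> [||| /or3P[]] /andP[/eqP-> _]; rewrite ?inE ?eqxx ?orbT //.
  by move: cW; rewrite !inE => /orP[/orP[]|] ->; rewrite ?orbT.
have fe u v : f u v -> e u v.
  by case/or4P=> [||| /or3P[]] /andP[/eqP-> /eqP->] //; rewrite e_sym.
have fz v : f z v -> v = c.
  by rewrite /= nza (negbTE nzx) (negbTE nzy) (eq_sym z c) (negbTE nac) eqxx => /eqP.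
have fx v : f x v -> v = a \/ v = z.
  rewrite /= nxa (negbTE nxy) (eq_sym x z) (negbTE nzx) eqxx /= orbF.
  by case/orP=> [/eqP|/andP[_ /eqP]]; [left|right].
have fy v : f y v -> v = a \/ v = z.
  rewrite /= nya nyx (eq_sym y z) (negbTE nzy) eqxx /= orbF.
  by case/orP=> [/eqP|/andP[_ /eqP]]; [left|right].
have fa v : f a v -> v \in [set x; y; z].
  rewrite /= nax nay naz eqxx /= orbF !inE.
  by case/or3P=> [->|->|/andP[_ ->]]; rewrite ?orbT.
(* A cycle needs two neighbours at each vertex. So it avoids [z], whose only neighbour is [c]; then
   [x] and [y], left with [a] alone; and then [a]. *)
have acyc : ~ has_cycle f.
  case=> s [s3 [sU sC]].
  have two v := @cycle_two_neighbors f s v fS s3 sU sC.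
  have zs : z \notin s.
    apply/negP=> /two[v [w [_ _ vw /fz E /fz E']]].
    by rewrite E E' eqxx in vw.
  have leaf t : (forall v, f t v -> v = a \/ v = z) -> t \notin s.
    move=> ft; apply/negP=> /two[v [w [vs ws vw /ft[] E /ft[] E']]]; subst.
    - by rewrite eqxx in vw.
    - by rewrite ws in zs.
    - by rewrite vs in zs.
    - by rewrite eqxx in vw.
  have as_ : a \notin s.
    apply/negP=> /two[v [_ [vs _ _ /fa + _]]].
    by rewrite !inE => /orP[/orP[]|] /eqP E; move: vs; rewrite E; apply/negP;
      do ?[exact: leaf].
  case: s s3 two zs leaf as_ {sU sC} => // t s _ two zs leaf as_.
  have ts : t \in t :: s by rewrite inE eqxx.
  have [v [_ [_ _ _ /fW + _]]] := two t ts.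
  by rewrite !inE => /orP[/orP[/orP[]|]|] /eqP E; move: ts; rewrite {1}E;
    apply/negP; do ?[exact: leaf].
have conn u : u \in W -> connect f u a.
  have xa : connect f x a by apply: connect1; rewrite /= !eqxx orbT.
  have ya : connect f y a by apply: connect1; rewrite /= !eqxx !orbT.
  have zc' : connect f z c by apply: connect1; rewrite /= !eqxx !orbT.
  rewrite !inE => /orP[/orP[/orP[]|]|] /eqP -> //.
  apply: connect_trans zc' _.
  by move: cW; rewrite !inE => /orP[/orP[]|] /eqP->.
have fC : connect_sym f := sym_connect_sym fS.
have WE : W :\ a = U.
  apply/setP=> u; rewrite !inE; have [->|//] := eqVneq u a.
    by rewrite /= (eq_sym a) nxa (eq_sym a) nya (eq_sym a) nza.
  by rewrite orbF.
have isolated u v w : u \in U -> e u v = false -> e u w = false ->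
    u != v -> U = [set u; v; w] -> ~~ connect (induced_rel e U) u v.
  move=> uU uv uw nuv EU; apply/negP=> /connect_neighbor/(_ nuv)[t [ut _]].
  by rewrite EU !inE => /orP[/orP[]|] /eqP E; rewrite E ?e_irr ?uv ?uw in ut.
(* By [nz], [z] misses [x] or [y]; the missed vertex is isolated once [a] is gone, so [a] is a cut
   vertex. *)
have nconn : ~~ connect (induced_rel e (W :\ a)) x y.
  rewrite WE; move: nz; rewrite negb_and => /orP[] /negbTE nz.
    by apply: (isolated x y z); rewrite ?inE ?eqxx //; adj.
  rewrite connect_induced_sym; apply: (isolated y x z).
  - by rewrite !inE eqxx orbT.
  - by adj.
  - by adj.
  - by rewrite eq_sym.
  - by apply/setP=> u; rewrite !inE (orbC (u == x)).
have aW : a \in W by rewrite !inE eqxx !orbT.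
have UW : U \subset W by apply/subsetP=> u; rewrite !inE => ->.
apply: (cS U).
- by rewrite /U -setUA cardsU1 cards2 !inE (eq_sym y z) nzy negb_or nxy (eq_sym x z) nzx.
- by apply/subsetP=> u; rewrite !inE => /orP[/orP[]|] /eqP->.
- exists W, f; split=> //; split=> //.
  + split=> // u v fuv; rewrite (fe _ _ fuv) (fW _ _ fuv) /=.
    exact: (fW v u (etrans (fS v u) fuv)).
  + split; first by apply/set0Pn; exists a.
    split=> // u v uW vW; apply: connect_trans (conn _ uW) _.
    by rewrite fC; apply: conn.
  + move=> u; rewrite -WE !inE => uW; rewrite uW andbT negbK => /eqP->.
    split=> //; exists x, y; split=> //.
    * by rewrite WE !inE eqxx.
    * by rewrite WE !inE eqxx orbT.
    * apply: (@connect_trans _ _ a); apply: connect1;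
        rewrite /induced_rel /W /= !inE !eqxx ?orbT ?andbT;
      by adj.
Qed.

(** * Cut vertices and the terminals of a minimal tree *)

Lemma connect_avoid (W : {set T}) r t y :
  r \in W -> t \in W -> t != r -> connect (induced_rel e W) y t ->
  connect (induced_rel e (W :\ r)) y t \/ connect (induced_rel e (W :\ t)) y r.
Proof.
move=> rW tW tr /connectP[p]; elim: p y => [|y1 p IH] y /=.
  by move=> _ ->; left.
case/andP=> /andP[/andP[yy1 yW] y1W] pth lst.
(* The walk is cut at its first visit to [r] or [t]; the part before it avoids the other vertex. *)
have [->|nyr] := eqVneq y r; first by right.
have [->|nyt] := eqVneq y t; first by left.
have [E|n1r] := eqVneq y1 r.
  by right; apply: connect1; rewrite /induced_rel /= !inE -E yy1 yW y1W nyt E eq_sym tr.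
have [E|n1t] := eqVneq y1 t.
  by left; apply: connect1; rewrite /induced_rel /= !inE -E yy1 yW y1W nyr E tr.
case: (IH y1 pth lst) => h; [left|right]; apply: connect_trans h;
  by apply: connect1; rewrite /induced_rel /= !inE yy1 yW y1W ?nyr ?nyt ?n1r ?n1t.
Qed.

(* A component of W - r free of U would contain a cut vertex x of W, and W - x
   then has a strictly smaller component that is also free of U. *)
Lemma component_meets_terminals (U W : {set T}) r x :
  {in W &, forall x y, connect (induced_rel e W) x y} ->
  (forall w, w \in W -> w \notin U -> cut_vertex e W w) ->
  r \in W -> x \in W :\ r ->
  exists2 u, u \in U & connect (induced_rel e (W :\ r)) x u.
Proof.
move=> cW cut.
have [n] := ubnP #|[set y | connect (induced_rel e (W :\ r)) x y]|.
elim: n r x => // n IH r x le_n rW; rewrite 2!inE => /andP[xr xW].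
have [xU|xU] := boolP (x \in U); first by exists x.
have [_ [y0 [z0 [y0W z0W _ /negP nyz]]]] := cut x xW xU.
(* The separated vertices [y0] and [z0] cannot both reach [r] without [x]. *)
have [y yWx nyr] : exists2 y, y \in W :\ x &
    ~~ connect (induced_rel e (W :\ x)) y r.
  have [yr|] := boolP (connect (induced_rel e (W :\ x)) y0 r); last by exists y0.
  exists z0 => //; apply/negP=> zr; apply: nyz.
  by apply: connect_trans yr _; rewrite connect_induced_sym.
(* By [connect_avoid], [y'] reaches [x] without [r] or reaches [r] without [x]; the choice of [y]
   rules out the latter. *)
have sub y' : connect (induced_rel e (W :\ x)) y y' ->
    connect (induced_rel e (W :\ r)) x y'.
  move=> yy'; have y'W := connect_induced_in yWx yy'.
  have y'W' : y' \in W by move: y'W; rewrite 2!inE => /andP[].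
  rewrite connect_induced_sym.
  case: (connect_avoid rW xW xr (cW _ _ y'W' xW)) => // h.
  by case/negP: nyr; apply: connect_trans yy' h.
have [u uU yu] : exists2 u, u \in U & connect (induced_rel e (W :\ x)) y u.
  apply: IH => //; rewrite ltnS in le_n; apply: leq_trans le_n.
  apply: proper_card; apply/properP; split.
    by apply/subsetP=> y'; rewrite !inE; apply: sub.
  exists x; rewrite inE //; apply/negP=> /(connect_induced_in yWx).
  by rewrite !inE eqxx.
by exists u => //; apply: sub.
Qed.

Lemma induced_path_connected u v p :
  induced_path e u v p ->
  {in [set x in p] &, forall x y, connect (induced_rel e [set x in p]) x y}.
Proof.
move=> [s [Ep [_ [_ E]]]].
have conn i : i < size p -> connect (induced_rel e [set x in p]) u (nth u p i).
  elim: i => [|i IH] lt_i; first by rewrite Ep.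
  have lt_i' := ltnW lt_i.
  apply: connect_trans (IH lt_i') _; apply: connect1.
  by rewrite /induced_rel /= !inE E // eqxx !mem_nth.
move=> x y; rewrite !inE => xp yp.
rewrite -(nth_index u xp) -(nth_index u yp).
apply: (@connect_trans _ _ u); last by apply: conn; rewrite index_mem.
by rewrite connect_induced_sym; apply: conn; rewrite index_mem.
Qed.

(** With its two ends as terminals, an induced path satisfies the same cut-vertex condition as a
    minimal tree, so [escape_card] handles both intervals. *)
Lemma induced_path_cut_vertex u v p w :
  induced_path e u v p -> w \in [set x in p] -> w \notin [set u; v] ->
  cut_vertex e [set x in p] w.
Proof.
move=> pP; have [s [Ep [Ev [pU E]]]] := pP.
rewrite !inE negb_or => wp /andP[wu wv].
have up : u \in p by rewrite Ep inE eqxx.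
have vp : v \in p by rewrite Ep -Ev mem_last.
split; first by rewrite inE.
exists u, v; split; rewrite ?inE 1?eq_sym ?wu ?wv //.
  by apply: (induced_path_connected pP); rewrite inE.
set W := _ :\ w.
(* Adjacent vertices have consecutive indices in [p], so a walk that avoids [w] cannot jump over its
   index. *)
have closed x y : connect (induced_rel e W) x y -> x \in p ->
    index x p < index w p -> index y p < index w p.
  case/connectP=> q; elim: q x => [|z q IH] x /=; first by move=> _ ->.
  case/andP=> /andP[/andP[xz _]]; rewrite !inE => /andP[zw zp] pth lst xp xw.
  apply: (IH z) => //.
  have zi : index z p != index w p.
    by apply: contraNneq zw => Ei; rewrite -(nth_index u zp) Ei nth_index.
  have := E (index x p) (index z p); rewrite !index_mem !nth_index // xz.
  move=> /(_ xp zp)/esym/orP[] /eqP Ei.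
    by rewrite ltn_neqAle zi Ei.
  by apply: leq_trans xw; rewrite Ei ltnW.
have lt_w : index w p < size p by rewrite index_mem.
have w_gt0 : 0 < index w p.
  by rewrite lt0n; apply: contra wu => /eqP Ei; rewrite -(nth_index u wp) Ei Ep.
apply/negP=> /closed/(_ up).
have -> : index u p = 0 by rewrite Ep /= eqxx.
have -> : index v p = (size p).-1.
  by rewrite -Ev Ep index_last // -Ep.
by move=> /(_ w_gt0); rewrite ltnNge -ltnS prednK ?lt_w // (leq_trans _ lt_w).
Qed.

(** * The union of the closed neighbourhoods of two extreme points *)

Section Neighborhoods.
Variables (X : {set T}) (a b : T).
Hypothesis X_conv : m33_convex e X.
Hypotheses (extr_a : m33_convex e (X :\ a)) (extr_b : m33_convex e (X :\ b)).

(** [cherry_extension] for the cherry [x], [c], [y] over [X :\ c], with [z] attached at [x]. *)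
Lemma extreme_twins c x y z :
  m33_convex e (X :\ c) -> x \in X -> y \in X -> z \in X ->
  e c x -> e c y -> e x y = false -> x != y -> e z x -> e z y.
Proof.
move=> [_ cX] xX yX zX cx cy xy nxy zx.
have [->//|zc] := eqVneq z c.
have nzy : z != y by apply: separated_neq zx _; adj.
have nzx := edge_neq zx.
have nxc : x != c by rewrite eq_sym; apply: edge_neq.
have nyc : y != c by rewrite eq_sym; apply: edge_neq.
have := @cherry_extension (X :\ c) c x y z cX.
by rewrite !inE eqxx zc nxc nyc zx orbT => /(_ isT xX yX zX cx cy xy nxy nzx nzy isT).
Qed.

(** The same cherry, with [z] attached at its centre [c]. *)
Lemma extreme_no_claw c x y z :
  m33_convex e (X :\ c) -> x \in X -> y \in X -> z \in X ->
  e c x -> e c y -> e c z -> x != y -> z != x -> z != y ->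
  e x y = false -> e z x.
Proof.
move=> [_ cX] xX yX zX cx cy cz nxy nzx nzy xy.
have nc t : e c t -> t != c by rewrite eq_sym; apply: edge_neq.
have := @cherry_extension (X :\ c) c x y z cX.
rewrite !inE eqxx !nc // (e_sym z c) cz => /(_ isT xX yX zX cx cy xy nxy nzx nzy isT).
by case/andP.
Qed.

Hypothesis private_adj : forall x y, x \in X -> y \in X -> e a x -> e b y ->
  e b x = false -> e a y = false -> e x y.

Let L := [set x in X | e a x || e b x].
Definition closed_neighborhoods := [set x in X | [|| x == a, x == b, e a x | e b x]].
Let K := closed_neighborhoods.

(** Without a common neighbour among [a] and [b], one vertex would be private to [a] and the other
    to [b], against [private_adj]. *)
Lemma nonadj_common_neighbor x y :
  x \in L -> y \in L -> e x y = false -> e a x && e a y || e b x && e b y.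
Proof.
rewrite !inE => /andP[xX xL] /andP[yX yL] xy.
case ax: (e a x) xL; case ay: (e a y) yL => //= by_ bx.
- case bx': (e b x); rewrite //=.
  by rewrite (private_adj xX yX ax by_ bx' ay) in xy.
- case by': (e b y); rewrite ?bx //=.
  by rewrite e_sym (private_adj yX xX ay bx by' ax) in xy.
- by rewrite bx.
Qed.

Lemma L_twins x y z : x \in L -> y \in L -> e x y = false -> x != y ->
  z \in X -> e z x -> e z y.
Proof.
move=> xL yL xy nxy zX zx; move: (xL) (yL); rewrite !inE => /andP[xX _] /andP[yX _].
case/orP: (nonadj_common_neighbor xL yL xy) => /andP[cx cy].
- exact: extreme_twins extr_a xX yX zX cx cy xy nxy zx.
- exact: extreme_twins extr_b xX yX zX cx cy xy nxy zx.
Qed.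

Lemma L_no_independent_triple x y z :
  x \in L -> y \in L -> z \in L -> x != y -> z != x -> z != y ->
  e x y = false -> e z x = false -> e z y = false -> False.
Proof.
move=> xL yL zL nxy nzx nzy xy zx zy.
have := nonadj_common_neighbor xL yL xy.
have := nonadj_common_neighbor zL xL zx.
have := nonadj_common_neighbor zL yL zy.
move: (xL) (yL) (zL); rewrite !inE => /andP[xX _] /andP[yX _] /andP[zX _] hzy hzx hxy.
(* Pigeonhole: two of the three pairs share the same centre, which then sees all three vertices and
   forms a claw. *)
have [|] : [&& e a x, e a y & e a z] \/ [&& e b x, e b y & e b z].
  by move: hzy hzx hxy; do 6!case: (e _ _) => //=; rewrite ?andbF //; auto.
- case/and3P=> cx cy cz.
  by rewrite (extreme_no_claw extr_a xX yX zX cx cy cz nxy nzx nzy xy) in zx.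
- case/and3P=> cx cy cz.
  by rewrite (extreme_no_claw extr_b xX yX zX cx cy cz nxy nzx nzy xy) in zx.
Qed.

(** Each component of [W :\ r] meets [L]. Vertices of [L] in different components are twins, hence
    isolated there, and a third component would give an independent triple in [L]. Only two such
    vertices and [r] remain. *)
Lemma escape_card (U W : {set T}) r :
  W \subset X -> U \subset K -> r \in W -> r \notin K ->
  {in W &, forall x y, connect (induced_rel e W) x y} ->
  (forall w, w \in W -> w \notin U -> cut_vertex e W w) ->
  #|W| <= 3.
Proof.
move=> WX UK rW rK conn cut.
have rU : r \notin U by apply: contra rK; apply: (subsetP UK).
have hitL x : x \in W :\ r ->
    exists2 y, y \in L & connect (induced_rel e (W :\ r)) x y.
  move=> xWr; have [u uU xu] := component_meets_terminals conn cut rW xWr.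
  have uWr := connect_induced_in xWr xu.
  have [ur uW] : u != r /\ u \in W by move: uWr; rewrite !inE => /andP[].
  have uK : u \in K by apply: (subsetP UK).
  have [uL|uL] := boolP (u \in L); first by exists u.
  (* A terminal outside [L] is [a] or [b], so any neighbour of it in [W] lies in [L] and differs
     from [r]. *)
  have [y [uy _ yW]] := connect_neighbor (conn _ _ uW rW) ur.
  have yX : y \in X by apply: (subsetP WX).
  have yL : y \in L.
    move: uK uL; rewrite !inE yX (subsetP WX _ uW) /= negb_or => /or4P[].
    - by move/eqP=> E; rewrite -E uy.
    - by move/eqP=> E; rewrite -E uy orbT.
    - by move=> ->. - by move=> ->; rewrite andbF.
  exists y => //; apply: connect_trans xu _; apply: connect1.
  have yr : y != r.
    by apply: contraNneq rK => <-; move: yL; rewrite !inE => /andP[-> /orP[]->]; rewrite ?orbT.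
  by rewrite /induced_rel /= uy uWr 2!inE yr yW.
have [_ [y0 [z0 [y0W z0W _ nyz]]]] := cut r rW rU.
have [x1 x1L y0x1] := hitL _ y0W; have [x2 x2L z0x2] := hitL _ z0W.
have x1W := connect_induced_in y0W y0x1; have x2W := connect_induced_in z0W z0x2.
have sepa : ~~ connect (induced_rel e (W :\ r)) x1 x2.
  apply: contra nyz => x12; apply: connect_trans y0x1 _; apply: connect_trans x12 _.
  by rewrite connect_induced_sym.
have n12 : x1 != x2 by apply: contraNneq sepa => ->; apply: connect0.
have edge x y : x \in W :\ r -> y \in W :\ r -> e x y ->
    connect (induced_rel e (W :\ r)) x y.
  by move=> xW yW xy; apply: connect1; rewrite /induced_rel /= xy xW yW.
have a12 : e x1 x2 = false.
  by apply: contraNF sepa; apply: edge.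
have WrX x : x \in W :\ r -> x \in X.
  by rewrite !inE => /andP[_]; apply: (subsetP WX).
(* By twinness, a neighbour of one of [x1], [x2] sees both and would join their components. *)
have no_common z : z \in W :\ r -> e z x1 || e z x2 -> False.
  move=> zW zx; have [z1 z2] : e z x1 /\ e z x2.
    have zX := WrX _ zW.
    case/orP: zx => zx; split=> //.
      exact: L_twins x1L x2L a12 n12 zX zx.
    by apply: L_twins x2L x1L _ _ zX zx; rewrite 1?e_sym 1?eq_sym.
  case/negP: sepa; apply: (@connect_trans _ _ z); last exact: edge.
  by rewrite connect_induced_sym; apply: edge.
have alone w x : w \in W :\ r -> x \in [set x1; x2] ->
    connect (induced_rel e (W :\ r)) w x -> w = x.
  move=> wW xx; rewrite connect_induced_sym => xw; apply/eqP.
  apply: contraT; rewrite eq_sym => nxw.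
  have [t [xt _ tW]] := connect_neighbor xw nxw.
  case: (no_common t tW); rewrite !(e_sym t).
  by move: xx; rewrite !inE => /orP[]/eqP E; rewrite -E xt ?orbT.
suff WE : W \subset x1 |: [set x2; r].
  apply: leq_trans (subset_leq_card WE) _; rewrite cardsU1 cards2.
  by case: (_ \notin _); case: (_ != _).
apply/subsetP=> w wW; apply: contraT; rewrite !inE !negb_or => /and3P[w1 w2 wr].
have wWr : w \in W :\ r by rewrite 2!inE wr.
have [x3 x3L wx3] := hitL w wWr.
have x3W := connect_induced_in wWr wx3.
have n31 : x3 != x1.
  apply: contraNneq w1 => E; apply/eqP/(alone w x1 wWr); [exact: set21 | by rewrite -E].
have n32 : x3 != x2.
  apply: contraNneq w2 => E; apply/eqP/(alone w x2 wWr); [exact: set22 | by rewrite -E].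
exfalso; apply: (L_no_independent_triple x1L x2L x3L) => //.
- by apply/negP=> h; apply: (no_common _ x3W); rewrite h.
- by apply/negP=> h; apply: (no_common _ x3W); rewrite h orbT.
Qed.

Lemma closed_neighborhoods_convex : m33_convex e closed_neighborhoods.
Proof.
have KX x : x \in K -> x \in X by rewrite inE => /andP[].
have [m3X m_3X] := X_conv; split.
- move=> u v x uK vK [p [pP [p3 xp]]]; apply: contraT => xK.
  have [s [Ep [_ [pU _]]]] := pP.
  have WX : [set y in p] \subset X.
    apply/subsetP=> y; rewrite inE => yp.
    by apply: (m3X u v y (KX u uK) (KX v vK)); exists p.
  have UK : [set u; v] \subset K.
    by apply/subsetP=> y; rewrite in_set2 => /orP[]/eqP->.
  have xW : x \in [set y in p] by rewrite inE.
  (* A path of length at least 3 has at least four vertices. *)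
  have := escape_card WX UK xW xK (induced_path_connected pP)
    (fun w => induced_path_cut_vertex pP).
  by rewrite cardsE (card_uniqP pU) leqNgt; move: p3; rewrite Ep /= ltnS => ->.
- move=> U U3 UK x [W [f [mT xW]]]; apply: contraT => xK.
  have [UW [fW _] [_ [fconn _]] cut] := mT.
  have UX : U \subset X by apply/subsetP=> y yU; apply/KX/(subsetP UK).
  have WX : W \subset X.
    by apply/subsetP=> y yW; apply: (m_3X U) => //; exists W, f.
  have conn : {in W &, forall x y, connect (induced_rel e W) x y}.
    move=> y z yW zW; apply: connect_sub (fconn _ _ yW zW) => s t /fW.
    by case/and3P=> st sW tW; apply: connect1; rewrite /induced_rel /= st sW.
  have := escape_card WX UK xW xK conn cut; rewrite leqNgt.
  (* Three terminals inside [K], and [x] outside it. *)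
  have -> // : 3 < #|W|; rewrite -U3; apply: proper_card; apply/properP.
  by split=> //; exists x => //; apply: contra xK; apply: (subsetP UK).
Qed.

End Neighborhoods.

(** * Minimal convex sets and their extreme points *)

Lemma minimal_convex (M Q : {set T} -> Prop) :
  M setT ->
  (forall X, M X -> Q X -> (forall x, extreme_point M X x -> ~ Q (X :\ x)) -> False) ->
  ~ Q setT.
Proof.
move=> MT minQ.
suff all_small n (X : {set T}) : #|X| < n -> M X -> ~ Q X
  by apply: (all_small #|T|.+1); rewrite ?cardsT.
elim: n X => // n IH X leXn MX QX; apply: (minQ X MX QX) => x [xX MXx].
by apply: IH => //; move: leXn; rewrite (cardsD1 x X) xX.
Qed.

Lemma m33_convexT : m33_convex e setT.
Proof. by split=> [u v x|U _ _ x]; rewrite inE. Qed.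

(** Lets a convex set with at most one extreme point be collapsed to that point. *)
Lemma m33_convex1 r : m33_convex e [set r].
Proof.
split=> [u v x /set1P -> /set1P -> [p [[s [Ep [Es [pU _]]]] [p3 _]]]|U U3 Ur].
  case: s Es Ep => [|y s] /= Es Ep; first by rewrite Ep in p3.
  by move: pU; rewrite Ep /= -{1}Es mem_last.
by have := subset_leq_card Ur; rewrite U3 cards1.
Qed.

(** The ends of the induced path survive the deletion of [x] and force [x] back. *)
Lemma extreme_not_inner (X : {set T}) u x y v :
  u \in X -> v \in X -> e u x -> e x y -> e y v ->
  e u y = false -> e u v = false -> e x v = false ->
  ~ extreme_point (m33_convex e) X x.
Proof.
move=> uX vX ux xy yv uy uv xv [xX [cX _]].
have nux := edge_neq ux.
have nvx : v != x by rewrite eq_sym; apply: (@separated_neq x v u); adj.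
have := m3_convex_P4 cX _ _ ux xy yv uy uv xv.
by rewrite !inE nux nvx uX vX eqxx /= => /(_ isT isT)[].
Qed.

(** * Excluding houses and then the A-graph *)

Section ConvexGeometry.
Hypothesis geom : convex_geometry (m33_convex e).

(** In a minimal convex set containing this house, each vertex of the 4-cycle is inner on an induced
    path with four vertices, so only the roof [r] can be extreme and the set collapses to [r]. *)
Lemma house_free r c1 c2 c3 c4 :
  e c1 c2 -> e c2 c3 -> e c3 c4 -> e c4 c1 -> e c1 c3 = false -> e c2 c4 = false ->
  e r c1 -> e r c2 -> e r c3 = false -> e r c4 = false -> False.
Proof.
move=> c12 c23 c34 c41 c13 c24 r1 r2 r3 r4.
pose Q (X : {set T}) := {subset [:: r; c1; c2; c3; c4] <= X}.
apply: (@minimal_convex (m33_convex e) Q) => [|X cX QX minX|x _];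
  [exact: m33_convexT | | by rewrite inE].
have [rX X1 X2 [X3 X4]] : [/\ r \in X, c1 \in X, c2 \in X & c3 \in X /\ c4 \in X].
  by split; last split; apply: QX; rewrite !inE eqxx ?orbT.
have ext x : extreme_point (m33_convex e) X x -> x = r.
  move=> xE; have [xh|xh] := boolP (x \in [:: r; c1; c2; c3; c4]); last first.
    case: (minX x xE) => y yh; rewrite !inE QX // andbT.
    by apply: contraNneq xh => <-.
  move: xh xE; rewrite !inE => /or4P[/eqP->|/eqP->|/eqP->|/orP[]/eqP->] // xE; exfalso.
  - by apply: (@extreme_not_inner X r c1 c4 c3 rX X3) xE; adj.
  - by apply: (@extreme_not_inner X r c2 c3 c4 rX X4) xE; adj.
  - by apply: (@extreme_not_inner X c4 c3 c2 r X4 rX) xE; adj.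
  - by apply: (@extreme_not_inner X c3 c4 c1 r X3 rX) xE; adj.
have /geom h := X1; have /set1P E : c1 \in [set r].
  apply: (h cX [set r] (m33_convex1 r)) => y /ext ->.
  by rewrite inE.
by rewrite E e_irr in r1.
Qed.

(** One field per pair: six edges and nine non-edges. Distinctness follows, as nonadjacent vertices
    are told apart by a third one. *)
Record A_config (a b u1 u2 u3 u4 : T) : Prop := AConfig {
  _ : e a u1; _ : e b u4; _ : e u1 u2; _ : e u2 u3; _ : e u3 u4; _ : e u4 u1;
  _ : e a b = false; _ : e a u2 = false; _ : e a u3 = false; _ : e a u4 = false;
  _ : e b u1 = false; _ : e b u2 = false; _ : e b u3 = false;
  _ : e u1 u3 = false; _ : e u2 u4 = false }.

Lemma A_config_sym a b u1 u2 u3 u4 :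
  A_config a b u1 u2 u3 u4 -> A_config b a u4 u3 u2 u1.
Proof. by case=> *; split; adj. Qed.

(** The A-graph is not fixed, because minimality is later contradicted by another one, with a
    pendant vertex replaced. *)
Definition contains_A (X : {set T}) := exists a b u1 u2 u3 u4,
  A_config a b u1 u2 u3 u4 /\ {subset [:: a; b; u1; u2; u3; u4] <= X}.

(** Otherwise [y] sees [u4] by twinness and misses [u2] and [u3] by house-freeness, so [y] can
    replace [b] in an A-graph inside [X :\ b]. *)
Lemma private_neighbor_anchor (X : {set T}) a b u1 u2 u3 u4 y :
  m33_convex e (X :\ b) -> ~ contains_A (X :\ b) ->
  A_config a b u1 u2 u3 u4 -> {subset [:: a; b; u1; u2; u3; u4] <= X} ->
  y \in X -> e b y -> e a y = false -> e y u1.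
Proof.
move=> cXb noA [au1 bu4 u12 u23 u34 u41 ab au2 au3 au4 bu1 bu2 bu3 u13 u24] AX yX bY ay.
apply: contraT => /negbTE yu1.
have [X1 X4] : u1 \in X /\ u4 \in X by split; apply: AX; rewrite !inE eqxx ?orbT.
have yu4 : e y u4.
  apply: contraT => /negbTE yu4; rewrite -yu1 e_sym.
  apply: (@extreme_twins X b u4 y u1 cXb) => //; try adj.
  by apply: (@separated_neq u4 y u1); adj.
exfalso; case yu2: (e y u2).
  by apply: (@house_free b y u4 u1 u2); adj.
case yu3: (e y u3).
  by apply: (@house_free y u3 u4 u1 u2); adj.
apply: noA; exists a, y, u1, u2, u3, u4; split; first by split; adj.
have nb z t : e z t -> e b t = false -> z != b by apply: separated_neq.
move=> z zA; rewrite !inE; apply/andP; split.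
  move: zA; rewrite !inE => /or4P[|||/or3P[]] /eqP->.
  - by apply: (@nb a u1); adj.
  - by rewrite eq_sym; apply: edge_neq.
  - by apply: (@nb u1 u2); adj.
  - by apply: (@nb u2 u3); adj.
  - by apply: (@nb u3 u2); adj.
  - by rewrite eq_sym; apply: edge_neq.
move: zA; rewrite inE => /predU1P[->|]; first by apply: AX; rewrite inE eqxx.
rewrite inE => /predU1P[->//|zA].
by apply: AX; rewrite 2!inE zA !orbT.
Qed.

Lemma private_neighbors_adj (X : {set T}) a b u1 u2 u3 u4 x y :
  m33_convex e (X :\ a) -> ~ contains_A (X :\ a) ->
  m33_convex e (X :\ b) -> ~ contains_A (X :\ b) ->
  A_config a b u1 u2 u3 u4 -> {subset [:: a; b; u1; u2; u3; u4] <= X} ->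
  x \in X -> y \in X -> e a x -> e b y -> e b x = false -> e a y = false -> e x y.
Proof.
move=> cXa noAa cXb noAb A AX xX yX ax bY bx ay; apply: contraT => /negbTE xy.
have yu1 := private_neighbor_anchor cXb noAb A AX yX bY ay.
have xu4 : e x u4.
  apply: (private_neighbor_anchor cXa noAa (A_config_sym A) _ xX ax bx).
  by move=> z zA; apply: AX; move: zA; rewrite !inE; do 6!case: (z == _).
case: A => au1 bu4 u12 u23 u34 u41 ab au2 au3 au4 bu1 bu2 bu3 u13 u24.
have [X1 X4] : u1 \in X /\ u4 \in X by split; apply: AX; rewrite !inE eqxx ?orbT.
(* If [x] missed [u1], they would be twins through [a], and [y], which sees [u1], would see [x]. *)
have xu1 : e x u1.
  apply: contraT => /negbTE xu1; rewrite -xy e_sym.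
  apply: (@extreme_twins X a u1 x y cXa) => //; try adj.
  by apply: (@separated_neq u1 x y); adj.
have yu4 : e y u4.
  apply: contraT => /negbTE yu4; rewrite -xy.
  apply: (@extreme_twins X b u4 y x cXb) => //; try adj.
  by apply: (@separated_neq u4 y x); adj.
(* The first four houses leave only [x] adjacent to [u2] and [y] to [u3]. The next two exclude a
   common neighbour [u3] or [u2], and the last settles the remaining case. *)
exfalso; case xu3: (e x u3); case xu2: (e x u2); case yu3: (e y u3); case yu2: (e y u2);
  first [ by apply: (@house_free x u1 u4 u3 u2); adj
        | by apply: (@house_free a x u1 u2 u3); adj
        | by apply: (@house_free y u4 u1 u2 u3); adj
        | by apply: (@house_free b y u4 u3 u2); adj
        | by apply: (@house_free a x u1 y u3); adj
        | by apply: (@house_free b y u4 x u2); adj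
        | by apply: (@house_free x u1 u2 u3 y); adj ].
Qed.

Lemma A_free : ~ contains_A setT.
Proof.
apply: (@minimal_convex (m33_convex e)) => [|X cX]; first exact: m33_convexT.
case=> a [b [u1 [u2 [u3 [u4 [A AX]]]]]] minX.
have [aX bX X1 [X2 X3 X4]] :
    [/\ a \in X, b \in X, u1 \in X & [/\ u2 \in X, u3 \in X & u4 \in X]].
  by split; last split; apply: AX; rewrite !inE eqxx ?orbT.
have ext x : extreme_point (m33_convex e) X x -> x = a \/ x = b.
  move=> xE; have [xh|xh] := boolP (x \in [:: a; b; u1; u2; u3; u4]); last first.
    case: (minX x xE); exists a, b, u1, u2, u3, u4; split=> // y yh.
    rewrite !inE AX // andbT.
    by apply: contraNneq xh => <-.
  case: A => au1 bu4 u12 u23 u34 u41 ab au2 au3 au4 bu1 bu2 bu3 u13 u24.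
  move: xh xE; rewrite !inE => /or4P[/eqP->|/eqP->|/eqP->|/or3P[]/eqP->] xE;
    [by left | by right | exfalso ..].
  - by apply: (@extreme_not_inner X a u1 u4 b aX bX) xE; adj.
  - by apply: (@extreme_not_inner X u3 u2 u1 a X3 aX) xE; adj.
  - by apply: (@extreme_not_inner X u2 u3 u4 b X2 bX) xE; adj.
  - by apply: (@extreme_not_inner X b u4 u1 a bX aX) xE; adj.
have hull := (geom cX _).1.
have ab : a != b by case: A => *; apply: (@separated_neq a b u1).
(* Extremality is an undecided [Prop], hence the double negation: if [c] is not extreme, [X]
   collapses to [d]. *)
have extr c d : c \in X -> c != d ->
    (forall x, extreme_point (m33_convex e) X x -> x = c \/ x = d) ->
    ~ ~ extreme_point (m33_convex e) X c.
  move=> cX' cd cdE nE.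
  have /set1P/eqP : c \in [set d].
    apply: (hull c cX' _ (m33_convex1 d)) => x xE; apply/set1P.
    by case: (cdE x xE) => // E; case: nE; rewrite -E.
  by apply/negP.
apply: (extr a b aX ab ext) => aE; apply: (extr b a bX).
- by rewrite eq_sym.
- by move=> x /ext[]; [right|left].
move=> bE; have [_ cXa] := aE; have [_ cXb] := bE.
have priv x y := @private_neighbors_adj X a b u1 u2 u3 u4 x y cXa (minX a aE) cXb (minX b bE) A AX.
have cK := closed_neighborhoods_convex cX cXa cXb priv.
have : u2 \in closed_neighborhoods X a b.
  apply: (hull u2 X2 _ cK) => x /ext[]->; rewrite inE ?aX ?bX eqxx ?orbT //.
case: A => au1 bu4 u12 u23 u34 u41 _ au2 au3 au4 bu1 bu2 bu3 u13 u24.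
(* [u2] sees neither pendant vertex, and its neighbour [u3] distinguishes it from both. *)
rewrite inE X2 au2 bu2 /= orbF => /orP[] /eqP E.
- by rewrite -E u23 in au3.
- by rewrite -E u23 in bu3.
Qed.

End ConvexGeometry.

End Graph.

Theorem theorem3 (T : finType) (e : rel T) :
  symmetric e -> irreflexive e -> connected_graph e ->
  convex_geometry (m33_convex e) ->
  ~ has_induced_A e.
Proof.
move=> e_sym e_irr _ geom [g [_ gE]].
apply: (A_free e_sym e_irr geom).
exists (g (@Ordinal 6 0 isT)), (g (@Ordinal 6 1 isT)), (g (@Ordinal 6 2 isT)),
  (g (@Ordinal 6 3 isT)), (g (@Ordinal 6 4 isT)), (g (@Ordinal 6 5 isT)).
by split=> [|x]; [split; rewrite gE | rewrite !inE].
Qed.
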